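(* Let $G$ be a discrete group and let $\mathbb{L}:G\to[0,\infty)$ be a length function on $G$ that has bounded doubling. For every $\varepsilon>0$ there exists a finite set $S_\varepsilon\subset G$ such that the following holds. If $f:G\to\mathbb{C}$ is any function for which $[D_{\mathbb{L}},\lambda_f]$ maps $c_c$ to $\ell^2(G)$ and extends to a bounded linear operator from $\ell^2(G)$ to $\ell^2(G)$ with $\|[D_{\mathbb{L}},\lambda_f]\|\le 1$, then there exists a decomposition $f=f_\sharp+f_\flat$ such that $f_\flat$ is supported on $S_\varepsilon$ and $\|\lambda_{f_\sharp}\|\le\varepsilon$ (that is, $\lambda_{f_\sharp}$ extends from $c_c$ to a bounded operator on $\ell^2(G)$ of norm at most $\varepsilon$). In particular, for any such $f$, $\lambda_f$ is necessarily an element of $C^*_r(G)$.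
   Context: A length function on a group $G$ with identity $e$ is a function $\mathbb{L}:G\to[0,\infty)$ with $\mathbb{L}(xy)\le \mathbb{L}(x)+\mathbb{L}(y)$, $\mathbb{L}(x^{-1})=\mathbb{L}(x)$, and $\mathbb{L}(x)=0$ if and only if $x=e$. Put $B(r)=\{x\in G:\mathbb{L}(x)\le r\}$. $\mathbb{L}$ has bounded doubling if $B(r)$ is finite for every $r<\infty$ and there is a constant $C_{\mathbb{L}}<\infty$ with $|B(2r)|\le C_{\mathbb{L}}|B(r)|$ for all $r\ge 1$. $c_c=C_c(G)$ is the space of finitely supported functions $G\to\mathbb{C}$. For an arbitrary function $f:G\to\mathbb{C}$ and $\xi\in c_c$, $(\lambda_f\xi)(x)=\sum_{y\in G}f(xy^{-1})\xi(y)$. $D_{\mathbb{L}}$ is the operator of pointwise multiplication by $\mathbb{L}$, so that $[D_{\mathbb{L}},\lambda_f]$ is well defined as a linear operator from $c_c$ to the space of all functions $G\to\mathbb{C}$, given by $([D_{\mathbb{L}},\lambda_f]\xi)(x)=\sum_y(\mathbb{L}(x)-\mathbb{L}(y))f(xy^{-1})\xi(y)$. $\|\cdot\|$ is the operator norm on $\ell^2(G)$. The reduced group $C^*$-algebra $C^*_r(G)$ is the operator-norm closure of $\{\lambda_g:g\in c_c\}$ in the bounded operators on $\ell^2(G)$. *)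

(* Defs.v *)
From HB Require Import structures.
From mathcomp Require Import all_boot all_order all_algebra.
From mathcomp Require Import finmap.
From mathcomp Require Import all_classical all_reals all_analysis.
From mathcomp.real_closed Require Import complex.
From mathcomp Require Import ring.

Set Implicit Arguments.
Unset Strict Implicit.
Unset Printing Implicit Defensive.
Import Order.TTheory GRing.Theory Num.Theory.
Import ComplexField.Normc.

Local Open Scope classical_set_scope.
Local Open Scope ring_scope.
Local Open Scope complex_scope.

Record length_function (R : realType) (G : groupType) (L : G -> R) : Prop := {
  length_ge0 : forall x, 0 <= L x ;
  length_mul : forall x y, L (x * y)%g <= L x + L y ;
  length_inv : forall x, L (x^-1)%g = L x ;
  length_eq0 : forall x, L x = 0 <-> x = 1%g }.

Definition lball (R : realType) (G : groupType) (L : G -> R) (r : R) : set G :=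
  [set x | L x <= r].

(* fset_set is meaningful here because the balls are required to be finite. *)
Definition bounded_doubling (R : realType) (G : groupType) (L : G -> R) : Prop :=
  (forall r : R, finite_set (lball L r)) /\
  exists C : R, forall r : R, 1 <= r ->
    #|` fset_set (lball L (2 * r))|%:R <= C * #|` fset_set (lball L r)|%:R.

Definition Cc (R : realType) (G : groupType) : set (G -> R[i]) :=
  [set xi | finite_set [set x | xi x != 0]].

Definition sqsum (R : realType) (G : groupType) (xi : G -> R[i]) : \bar R :=
  \esum_(x in [set: G]) ((normc (xi x)) ^+ 2)%:E.

Definition ell2 (R : realType) (G : groupType) : {pred G -> R[i]} :=
  fun xi => (sqsum xi < +oo)%E.

Lemma esumZ_ltoo (R : realType) (T : choiceType) (a : T -> R) (c : R) :
  0 <= c -> (forall x, 0 <= a x) ->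
  (\esum_(x in [set: T]) (a x)%:E < +oo)%E ->
  (\esum_(x in [set: T]) (c * a x)%:E < +oo)%E.
Proof.
move=> c0 a0 aoo.
apply: (@le_lt_trans _ _ (c%:E * \esum_(x in [set: T]) (a x)%:E)%E).
  apply: ge_ereal_sup => _ [F [finF _] <-].
  rewrite (_ : (\sum_(x \in F) _)%E = (c%:E * \sum_(x \in F) (a x)%:E)%E).
    apply: lee_wpmul2l; first by rewrite lee_fin.
    by apply: ereal_sup_ubound; exists F.
  rewrite !fsbig_finite//= !sumEFin -EFinM; congr (_%:E).
  by rewrite big_distrr.
by rewrite lte_mul_pinfty.
Qed.

Lemma ell2_submod (R : realType) (G : groupType) :
  submod_closed (@ell2 R G).
Proof.
have S0 : (0 : G -> R[i]) \in @ell2 R G.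
  rewrite unfold_in /sqsum esum1 ?ltry// => x _.
  by rewrite normc0 expr0n.
have SZ (c : R[i]) (xi : G -> R[i]) : xi \in @ell2 R G -> (c *: xi) \in @ell2 R G.
  rewrite !unfold_in /sqsum => h.
  rewrite (_ : esum _ _ =
    \esum_(x in [set: G]) (normc c ^+ 2 * normc (xi x) ^+ 2)%:E).
    by apply: esumZ_ltoo => // [|x]; rewrite sqr_ge0.
  by apply: eq_esum => x _; rewrite -exprMn -normcM.
split => // c u v /(SZ c) hu hv; move: (c *: u) hu hv => {}u.
rewrite !unfold_in /sqsum => hu hv.
have nn (f : G -> R[i]) x : [set: G] x -> (0 <= (2 * normc (f x) ^+ 2)%:E)%E.
  by rewrite lee_fin mulr_ge0// sqr_ge0.
apply: (@le_lt_trans _ _ (\esum_(x in [set: G])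
    ((2 * normc (u x) ^+ 2)%:E + (2 * normc (v x) ^+ 2)%:E))%E).
  apply: le_esum => x _; rewrite -EFinD lee_fin.
  have := le_normcD (u x) (v x); set n := normc (u x + v x) => h.
  change (n ^+ 2 <= 2 * normc (u x) ^+ 2 + 2 * normc (v x) ^+ 2).
  have n0 : 0 <= n by rewrite /n; case: (u x + v x) => a b /=; exact: sqrtr_ge0.
  apply: (@le_trans _ _ ((normc (u x) + normc (v x)) ^+ 2)).
    by rewrite lerXn2r// nnegrE (le_trans n0).
  rewrite -subr_ge0 (_ : _ - _ = (normc (u x) - normc (v x)) ^+ 2) ?sqr_ge0//.
  by rewrite !expr2; ring.
rewrite esumD; [|exact: nn|exact: nn].
by apply: lte_add_pinfty; apply: esumZ_ltoo => // x; rewrite sqr_ge0.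
Qed.

HB.instance Definition _ (R : realType) (G : groupType) :=
  GRing.isSubmodClosed.Build R[i] (G -> R[i]) (@ell2 R G) (@ell2_submod R G).

Record l2 (R : realType) (G : groupType) : Type :=
  L2 { l2val :> G -> R[i] ; l2P : l2val \in @ell2 R G }.

HB.instance Definition _ (R : realType) (G : groupType) :=
  [isSub for @l2val R G].
HB.instance Definition _ (R : realType) (G : groupType) :=
  [Choice of l2 R G by <:].
HB.instance Definition _ (R : realType) (G : groupType) :=
  [SubChoice_isSubLmodule of l2 R G by <:].

Lemma Cc_ell2 (R : realType) (G : groupType) (xi : G -> R[i]) :
  Cc xi -> xi \in @ell2 R G.
Proof.
move=> fxi; rewrite unfold_in /sqsum.
rewrite (_ : esum _ _ =
  \esum_(x in [set x | xi x != 0]) (normc (xi x) ^+ 2)%:E).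
  rewrite esum_fset// => [|x _]; last by rewrite lee_fin sqr_ge0.
  by rewrite fsbig_finite//= sumEFin ltry.
rewrite [RHS]esum_mkcond; apply: eq_esum => x _.
case: ifPn => //; rewrite notin_setE /= => /negP; rewrite negbK => /eqP ->.
by rewrite normc0 expr0n.
Qed.

Definition l2norm (R : realType) (G : groupType) (xi : l2 R G) : R :=
  Num.sqrt (fine (sqsum xi)).

(* The value is +oo exactly when T is unbounded. *)
Definition opnorm (R : realType) (G : groupType) (T : l2 R G -> l2 R G) : \bar R :=
  ereal_sup [set (l2norm (T xi))%:E | xi in [set xi | l2norm xi <= 1]].

(* xi is meant to have finite support, so that the finitely supported sum
   below is the full sum over G. *)
Definition lambda (R : realType) (G : groupType) (f xi : G -> R[i]) : G -> R[i] :=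
  fun x => \sum_(y \in [set: G]) f (x * y^-1)%g * xi y.

Definition Dmul (R : realType) (G : groupType) (L : G -> R) (xi : G -> R[i]) :
  G -> R[i] := fun x => (L x)%:C * xi x.

Definition commD (R : realType) (G : groupType) (L : G -> R) (f xi : G -> R[i]) :
  G -> R[i] := fun x => Dmul L (lambda f xi) x - lambda f (Dmul L xi) x.

Lemma commDE (R : realType) (G : groupType) (L : G -> R) (f xi : G -> R[i]) x :
  Cc xi ->
  commD L f xi x =
    \sum_(y \in [set: G]) (L x - L y)%:C * f (x * y^-1)%g * xi y.
Proof.
move=> fxi; rewrite /commD /Dmul /lambda.
have E (h : G -> R[i]) : (forall y, xi y = 0 -> h y = 0) ->
    \sum_(y \in [set: G]) h y = \sum_(y <- fset_set [set y | xi y != 0]) h y.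
  move=> h0; rewrite -fsbig_finite//; apply/esym/fsbig_widen => //.
  by move=> y [_ /=] /negP; rewrite negbK => /eqP /h0.
rewrite !E; try by move=> y ->; rewrite ?mulr0.
rewrite big_distrr /= -sumrB; apply: eq_bigr => y _.
by rewrite rmorphB /=; ring.
Qed.

(* T extends A from C_c(G) to l2(G); since T is l2-valued, this forces A to map
   C_c(G) into l2(G). *)
Definition extends_Cc (R : realType) (G : groupType)
    (A : (G -> R[i]) -> (G -> R[i])) (T : {linear l2 R G -> l2 R G}) : Prop :=
  forall (xi : G -> R[i]) (hxi : Cc xi), l2val (T (L2 (Cc_ell2 hxi))) = A xi.

(* A maps C_c(G) into l2(G) and extends to a bounded linear operator on l2(G)
   of norm at most c. *)
Definition norm_extension_le (R : realType) (G : groupType)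
    (A : (G -> R[i]) -> (G -> R[i])) (c : R) : Prop :=
  exists T : {linear l2 R G -> l2 R G}, extends_Cc A T /\ (opnorm T <= c%:E)%E.

Definition reduced_Cstar (R : realType) (G : groupType) :
    set {linear l2 R G -> l2 R G} :=
  [set T : {linear l2 R G -> l2 R G} | (opnorm T < +oo)%E /\
    forall e : R, 0 < e ->
      exists (g : G -> R[i]) (Tg : {linear l2 R G -> l2 R G}),
        [/\ Cc g, extends_Cc (lambda g) Tg, (opnorm Tg < +oo)%E &
            (opnorm (fun xi => (T xi - Tg xi)%R) < e%:E)%E]].

(* Main.v *)
Require Import Defs.
From HB Require Import structures.
From mathcomp Require Import all_boot all_order all_algebra.
From mathcomp Require Import finmap.
From mathcomp Require Import all_classical all_reals all_analysis.
From mathcomp.real_closed Require Import complex.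
From mathcomp Require Import ring lra.

Set Implicit Arguments.
Unset Strict Implicit.
Unset Printing Implicit Defensive.
Import Order.TTheory GRing.Theory Num.Theory.
Import ComplexField.Normc.
Import numFieldNormedType.Exports.

Local Open Scope classical_set_scope.
Local Open Scope ring_scope.
Local Open Scope complex_scope.

(** Everything is done with kernels [k x y] on finite blocks.  The operator
    [lambda f] has kernel [f (x y^-1)], its commutator with multiplication by
    [L] has kernel [(L x - L y) f (x y^-1)], and a kernel is an operator of norm
    at most [c] as soon as all its finite blocks obey the bilinear bound
    [kernel_le].

    Two mechanisms give the theorem.

    (1) Averaging over right translates ([kernel_le_overlap]).  Write [|A|] for
    the number of elements of a finite set [A].  If [A] is contained in [B] and,
    for each [w], the part of [k] going from the translate [A w^-1] to the
    translate [B w^-1] has norm at most [c], then the sum of these parts divided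
    by [|A|] has norm at most [c |B| / |A|], because each point lies in [|A|],
    respectively [|B|], of the translates.  The result is [k] multiplied by a
    function of [x y^-1], namely [|A|^-1 |{a in A : x y^-1 a in B}|], called
    [overlap A B].
    For [A = B(r)] and [B = B(2r)] the function is a cutoff equal to [1] on
    [B(r)] and to [0] off [B(3r)], and bounded doubling says that multiplying
    [f] by it enlarges the norm of the commutator by a bounded factor at most.

    (2) Solving a Sylvester equation ([kernel_le_sylvester]).  If [k] maps
    functions living where [0 <= L <= a] to functions living where [L >= b > a],
    then dividing its commutator by [L x - L y] is harmless: the norm of [k] is
    at most that of its commutator divided by [b - a].

    Let [f] have commutator of norm at most [1], and let [g] be [f] multiplied by
    the difference of the cutoffs at scales [2r] and [r], so that [g] lives on
    [r < L <= 6r].  By (1) its commutator is bounded independently of [r].  A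
    function on [B(r/4)] is mapped by [lambda g] to one on [L >= 3r/4], so (2)
    bounds this part of [lambda g] by a constant times [1/r]; the same holds for
    every right translate of [B(r/4)], since [lambda g] commutes with right
    translations.  The image moreover lives on [B(8r)], and
    [overlap B(r/4) B(8r)] is equal to [1] on the support of [g], so (1) once
    more, with bounded doubling, turns the local bounds into a
    bound [O(1/r)] for [lambda g] itself ([conv_kernel_annulus]).  Summing over
    [r = 2^j] with [j >= J] gives a bound [O(2^-J)] for the part of [f] beyond
    the cutoff at scale [2^J] ([conv_kernel_tail]).  That part is the small
    summand; what is left of [f] is supported in [B(3 2^J)].

    Membership in the reduced C*-algebra follows at once: [lambda f] is a norm
    limit of the [lambda g] for the finitely supported summands [g]. *)

(** * Complex moduli *)

Section ComplexFacts.
Variable R : realType.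
Implicit Types (z w : R[i]) (a : R).

Lemma Re_real_mul a z : complex.Re (a%:C * z) = a * complex.Re z.
Proof. by case: z => p q /=; rewrite mul0r subr0. Qed.

Lemma normc_ge0 z : 0 <= normc z.
Proof. by case: z => p q /=; exact: sqrtr_ge0. Qed.

Lemma normc_sqr z : normc z ^+ 2 = complex.Re z ^+ 2 + complex.Im z ^+ 2.
Proof. by case: z => p q /=; rewrite sqr_sqrtr// addr_ge0// sqr_ge0. Qed.

Lemma normc_real a : normc a%:C = `|a|.
Proof. by rewrite /= expr0n addr0 sqrtr_sqr. Qed.

Lemma Re_le_normc z : complex.Re z <= normc z.
Proof.
apply: (le_trans (ler_norm _)); rewrite -(@ler_pXn2r _ 2)// ?nnegrE ?normc_ge0//.
by rewrite normc_sqr -normrX ger0_norm ?sqr_ge0// lerDl sqr_ge0.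
Qed.

Lemma Re_sum (I : Type) (s : seq I) (P : pred I) (F : I -> R[i]) :
  complex.Re (\sum_(i <- s | P i) F i) = \sum_(i <- s | P i) complex.Re (F i).
Proof. by apply: (big_morph (@complex.Re R)) => // -[a b] [c d]. Qed.

Lemma Im_sum (I : Type) (s : seq I) (P : pred I) (F : I -> R[i]) :
  complex.Im (\sum_(i <- s | P i) F i) = \sum_(i <- s | P i) complex.Im (F i).
Proof. by apply: (big_morph (@complex.Im R)) => // -[a b] [c d]. Qed.

Lemma Re_conj_mul z : complex.Re (z * z^*%C) = normc z ^+ 2.
Proof. by rewrite normc_sqr; case: z => p q /=; rewrite mulrN opprK !expr2. Qed.

Lemma normc_conj z : normc z^*%C = normc z.
Proof. by case: z => p q /=; rewrite sqrrN. Qed.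
End ComplexFacts.

(** * Bilinear bounds for finite blocks of kernels *)

Section Bilinear.
Variables (R : realType) (G : groupType).
Implicit Types (E F : {fset G}) (k : G -> G -> R[i]) (xi eta : G -> R[i]).

Definition sqn E xi : R := \sum_(y <- E) normc (xi y) ^+ 2.

(** The bilinear, not sesquilinear, form: the conjugation is absorbed by the
    arbitrary test function [eta].  Likewise the real part stands for the
    modulus, as [eta] can be multiplied by a phase. *)
Definition pairing E F k xi eta : R :=
  \sum_(x <- F) \sum_(y <- E) complex.Re (k x y * (xi y * eta x)).

(** By rescaling [xi] and [eta] against each other, this says that the block of
    [k] with rows in [F] and columns in [E] has operator norm at most [c].  In
    this homogenised form the bound is linear in the squared norms, so that it
    can be summed and averaged without the Cauchy-Schwarz inequality. *)
Definition kernel_le E F k (c : R) :=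
  forall xi eta, 2 * pairing E F k xi eta <= c * (sqn E xi + sqn F eta).

Definition kernel_bounded k (c : R) := forall E F, kernel_le E F k c.

Lemma sqn_ge0 E xi : 0 <= sqn E xi.
Proof. by apply: sumr_ge0 => y _; rewrite sqr_ge0. Qed.

Lemma le_sqn E xi xi' :
  (forall y, normc (xi y) <= normc (xi' y)) -> sqn E xi <= sqn E xi'.
Proof.
by move=> h; apply: ler_sum => y _; rewrite lerXn2r// nnegrE normc_ge0.
Qed.

Lemma eq_kernel_le E F k k' c :
  (forall x y, x \in F -> y \in E -> k x y = k' x y) ->
  kernel_le E F k c -> kernel_le E F k' c.
Proof.
move=> kk' h xi eta; rewrite (_ : pairing E F k' xi eta = pairing E F k xi eta) //.
by apply: eq_big_seq => x xF; apply: eq_big_seq => y yE; rewrite kk'.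
Qed.

Lemma kernel_le_weaken E F k c c' : c <= c' -> kernel_le E F k c -> kernel_le E F k c'.
Proof.
move=> cc' h xi eta; apply: (le_trans (h xi eta)).
by rewrite ler_wpM2r// addr_ge0// sqn_ge0.
Qed.

Lemma kernel_leD E F k k' c c' : kernel_le E F k c -> kernel_le E F k' c' ->
  kernel_le E F (fun x y => k x y + k' x y) (c + c').
Proof.
move=> h h' xi eta; rewrite [leRHS]mulrDl.
apply: (le_trans _ (lerD (h xi eta) (h' xi eta))).
rewrite -mulrDr ler_pM2l// /pairing -big_split/=.
apply: ler_sum => x _; rewrite -big_split/=; apply: ler_sum => y _.
by rewrite mulrDl raddfD.
Qed.

Lemma kernel_leN E F k c : kernel_le E F k c -> kernel_le E F (fun x y => - k x y) c.
Proof.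
move=> h xi eta; apply: (le_trans _ (le_trans (h xi (fun x => - eta x)) _)).
  rewrite ler_pM2l//; apply: ler_sum => x _; apply: ler_sum => y _.
  by rewrite !mulrN mulNr.
have -> // : sqn F (fun x => - eta x) = sqn F eta.
by apply: eq_bigr => x _; rewrite normcN.
Qed.

Lemma kernel_le_sum E F (I : Type) (s : seq I) (k : I -> G -> G -> R[i]) (c : I -> R) :
  (forall i, kernel_le E F (k i) (c i)) ->
  kernel_le E F (fun x y => \sum_(i <- s) k i x y) (\sum_(i <- s) c i).
Proof.
move=> h; elim: s => [|i s IH].
  move=> xi eta; rewrite big_nil mul0r.
  rewrite (_ : pairing _ _ _ _ _ = 0) ?mulr0//.
  by rewrite /pairing big1// => x _; rewrite big1// => y _; rewrite big_nil mul0r.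
rewrite big_cons; apply: eq_kernel_le (kernel_leD (h i) IH) => x y _ _.
by rewrite big_cons.
Qed.

(** The starting point of the iteration in [kernel_le_sylvester]. *)
Lemma kernel_le_crude E F k : exists2 M, 0 <= M & kernel_le E F k M.
Proof.
exists (\sum_(x <- F) \sum_(y <- E) normc (k x y)).
  by apply: sumr_ge0 => x _; apply: sumr_ge0 => y _; rewrite normc_ge0.
move=> xi eta; rewrite /pairing mulr_sumr mulr_suml big_seq [leRHS]big_seq.
apply: ler_sum => x xF; rewrite mulr_sumr mulr_suml big_seq [leRHS]big_seq.
apply: ler_sum => y yE.
have hy : normc (xi y) ^+ 2 <= sqn E xi.
  by rewrite /sqn (big_fsetD1 y)//= lerDl; exact: sqn_ge0.
have hx : normc (eta x) ^+ 2 <= sqn F eta.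
  by rewrite /sqn (big_fsetD1 x)//= lerDl; exact: sqn_ge0.
apply: (@le_trans _ _ (2 * (normc (k x y) * (normc (xi y) * normc (eta x))))).
  by rewrite ler_pM2l// -!normcM Re_le_normc.
rewrite mulrCA ler_wpM2l ?normc_ge0//; apply: (le_trans _ (lerD hy hx)).
by have := sqr_ge0 (normc (xi y) - normc (eta x)); nra.
Qed.

Lemma kernel_le_restrict E F k c (P Q : pred G) : 0 <= c -> kernel_le E F k c ->
  kernel_le E F (fun x y => if P x && Q y then k x y else 0) c.
Proof.
move=> c0 h xi eta.
apply: (le_trans _ (le_trans (h (fun y => if Q y then xi y else 0)
  (fun x => if P x then eta x else 0)) _)).
  rewrite ler_pM2l//; apply: ler_sum => x _; apply: ler_sum => y _.
  by case: (P x); case: (Q y); rewrite /= ?(mul0r, mulr0).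
by rewrite ler_wpM2l// lerD//; apply: le_sqn => y; case: ifP; rewrite ?normc0 ?normc_ge0.
Qed.

Lemma kernel_bounded_translate k c w : kernel_bounded k c ->
  kernel_bounded (fun x y => k (x * w)%g (y * w)%g) c.
Proof.
move=> h E F xi eta; pose s := fun y : G => (y * w)%g.
have si : injective s by exact: mulIg.
have := h (s @` E)%fset (s @` F)%fset
  (fun y => xi (y * w^-1)%g) (fun y => eta (y * w^-1)%g).
have sum_im (D : {fset G}) (f : G -> R) : \sum_(x <- (s @` D)%fset) f x = \sum_(x <- D) f (s x).
  by rewrite big_imfset//= => ? ? _ _; exact: si.
rewrite /pairing /sqn !sum_im.
under eq_bigr => x _ do rewrite sum_im.
rewrite /s; under eq_bigr => x _ do under eq_bigr => y _ do rewrite !mulgK.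
under [X in _ <= _ * (X + _)]eq_bigr => y _ do rewrite mulgK.
by under [X in _ <= _ * (_ + X)]eq_bigr => y _ do rewrite mulgK.
Qed.

(** Where [k] does not vanish, [k x y = (d x y + k x y * l y) / l x] with [d]
    the commutator kernel, and [l x >= b].  Hence any bound [M] for [k] improves to
    [(c + a M) / b].  The map [M |-> (c + a M) / b] is a contraction with fixed
    point [c / (b - a)], so iterating from a crude bound gives the claim. *)
Lemma kernel_le_sylvester E F k (l : G -> R) (a b c : R) : 0 < a -> a < b -> 0 <= c ->
  (forall x y, k x y != 0 -> b <= l x /\ 0 <= l y <= a) ->
  kernel_le E F (fun x y => (l x - l y)%:C * k x y) c ->
  kernel_le E F k (c / (b - a)).
Proof.
move=> a0 ab c0 supp hc.
have b0 : 0 < b := lt_trans a0 ab.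
have ba0 : b - a != 0 by rewrite subr_eq0 gt_eqF.
have step M : 0 <= M -> kernel_le E F k M -> kernel_le E F k ((c + a * M) / b).
  move=> M0 hM xi eta.
  (* The weights l y / a and b / l x are at most 1 where k does not vanish. *)
  pose xi' y := (if 0 <= l y <= a then l y / a else 0)%:C * xi y.
  pose eta' x := (if b <= l x then b / l x else 0)%:C * eta x.
  have xi'_le : sqn E xi' <= sqn E xi.
    apply: le_sqn => y; rewrite /xi' normcM normc_real.
    rewrite -[leRHS]mul1r ler_wpM2r ?normc_ge0//.
    case: ifP => [/andP[y0 ya]|_]; last by rewrite normr0.
    by rewrite ger0_norm ?divr_ge0 ?(ltW a0)// ler_pdivrMr// mul1r.
  have eta'_le : sqn F eta' <= sqn F eta.
    apply: le_sqn => x; rewrite /eta' normcM normc_real.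
    rewrite -[leRHS]mul1r ler_wpM2r ?normc_ge0//.
    case: ifP => [bx|_]; last by rewrite normr0.
    have lx0 := lt_le_trans b0 bx.
    by rewrite ger0_norm ?divr_ge0 ?(ltW b0) ?(ltW lx0)// ler_pdivrMr// mul1r.
  have -> : pairing E F k xi eta = b^-1 * pairing E F (fun x y => (l x - l y)%:C * k x y) xi eta'
      + (a / b) * pairing E F k xi' eta'.
    rewrite /pairing !mulr_sumr -big_split/=; apply: eq_bigr => x _.
    rewrite !mulr_sumr -big_split/=; apply: eq_bigr => y _.
    have [->|k0] := eqVneq (k x y) 0; first by rewrite !(mulr0, mul0r) addr0.
    have [bx ly] := supp _ _ k0; rewrite /xi' /eta' bx ly.
    have -> : (l x - l y)%:C * k x y * (xi y * ((b / l x)%:C * eta x)) =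
        ((l x - l y) * (b / l x))%:C * (k x y * (xi y * eta x)).
      by rewrite (rmorphM _ (l x - l y)) /=; ring.
    have -> : k x y * ((l y / a)%:C * xi y * ((b / l x)%:C * eta x)) =
        (l y / a * (b / l x))%:C * (k x y * (xi y * eta x)).
      by rewrite (rmorphM _ (l y / a)) /=; ring.
    rewrite !Re_real_mul; field.
    by rewrite !gt_eqF// (lt_le_trans b0).
  have h1 := hc xi eta'; have h2 := hM xi' eta'.
  rewrite [leLHS](_ : _ = b^-1 * (2 * pairing E F (fun x y => (l x - l y)%:C * k x y) xi eta'
      + a * (2 * pairing E F k xi' eta'))); last by field; rewrite gt_eqF.
  rewrite [leRHS](_ : _ = b^-1 * (c * (sqn E xi + sqn F eta) + a * (M * (sqn E xi + sqn F eta)))); last by ring.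
  rewrite ler_pM2l ?invr_gt0// lerD//.
    by apply: (le_trans h1); rewrite ler_wpM2l// lerD2l.
  by rewrite ler_pM2l//; apply: (le_trans h2); rewrite ler_wpM2l// lerD.
have [M0 M0_ge0 hM0] := kernel_le_crude E F k.
have t0 : 0 <= a / b by rewrite divr_ge0// ltW.
have cba : 0 <= c / (b - a) by rewrite divr_ge0// subr_ge0 ltW.
have iter n : kernel_le E F k (c / (b - a) + M0 * (a / b) ^+ n).
  elim: n => [|n IH].
    by rewrite expr0 mulr1; apply: kernel_le_weaken hM0; rewrite lerDr.
  apply: kernel_le_weaken (step _ _ IH); last first.
    by rewrite addr_ge0// mulr_ge0// exprn_ge0.
  rewrite exprS le_eqVlt; apply/orP; left; apply/eqP.
  move: (_ ^+ n) => t; field.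
  by rewrite ba0 gt_eqF.
move=> xi eta.
have cv : ((c / (b - a) + M0 * (a / b) ^+ n) * (sqn E xi + sqn F eta)) @[n --> \oo]
    --> (c / (b - a) + M0 * 0) * (sqn E xi + sqn F eta).
  apply: cvgMl; apply: cvgD; first exact: cvg_cst.
  apply: cvgMr; apply: cvg_expr.
  by rewrite ger0_norm// ltr_pdivrMr// mul1r.
rewrite mulr0 addr0 in cv.
rewrite -(cvg_lim _ cv)//; apply: limr_ge; first by apply/cvg_ex; eexists; exact: cv.
by apply: nearW => n; exact: iter.
Qed.

End Bilinear.

(** * Averaging over translates *)

Section Averaging.
Variables (R : realType) (G : groupType).
Implicit Types (E F A B W : {fset G}) (k : G -> G -> R[i]).

Lemma sum_fset_le (I : choiceType) (A B : {fset I}) (v : I -> R) :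
  (A `<=` B)%fset -> (forall x, 0 <= v x) ->
  \sum_(x <- A) v x <= \sum_(x <- B) v x.
Proof.
move=> AB v0.
rewrite (_ : \sum_(x <- A) v x = \sum_(x <- A) (if x \in A then v x else 0)).
  rewrite (big_fset_incl _ AB); first by apply: ler_sum => x _; case: ifP.
  by move=> x _ /negbTE ->.
by apply: eq_big_seq => x ->.
Qed.

(** A sum over [W] of values at points [s w] of [B] is, for injective [s], a sum
    over the part of [B] that [W] reaches. *)
Lemma sum_preimage W B (s : G -> G) (v : G -> R) : injective s ->
  exists2 D : {fset G}, (D `<=` B)%fset /\
     (forall w, w \in W -> s w \in B -> s w \in D) &
  \sum_(w <- W) (if s w \in B then v (s w) else 0) = \sum_(b <- D) v b.
Proof.
move=> si; pose D := [fset w in W | s w \in B]%fset; exists (s @` D)%fset.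
  split; first by apply/fsubsetP => _ /imfsetP[w /= + ->]; rewrite !inE => /andP[].
  by move=> w wW swB; apply/imfsetP; exists w => //=; rewrite !inE wW.
rewrite big_imfset//=; last by move=> ? ? _ _; exact: si.
by rewrite -big_mkcond big_fset_condE.
Qed.

Lemma sum_preimage_le W B (s : G -> G) (v : G -> R) :
  injective s -> (forall x, 0 <= v x) ->
  \sum_(w <- W) (if s w \in B then v (s w) else 0) <= \sum_(b <- B) v b.
Proof.
move=> si v0; have [D [DB _] ->] := sum_preimage W B v si.
exact: sum_fset_le.
Qed.

Lemma sum_preimage_eq W B (s : G -> G) (v : G -> R) : injective s ->
  (forall b, b \in B -> exists2 w, w \in W & s w = b) ->
  \sum_(w <- W) (if s w \in B then v (s w) else 0) = \sum_(b <- B) v b.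
Proof.
move=> si sB; have [D [DB BD] ->] := sum_preimage W B v si.
suff -> : D = B by [].
apply/eqP; rewrite eqEfsubset DB/=; apply/fsubsetP => b bB.
by have [w wW wb] := sB _ bB; rewrite -wb; apply: BD; rewrite ?wb.
Qed.

(** The convolution of the indicator functions of [B] and [A^-1], divided by
    [|A|]: a matrix coefficient of the regular
    representation, hence a bounded multiplier. *)
Definition overlap A B (x : G) : R :=
  (#|` A|%:R)^-1 * \sum_(a <- A) (if (x * a)%g \in B then 1 else 0).

Lemma sum_cst_fset A (c : R) : \sum_(x <- A) c = c * #|` A|%:R.
Proof. by rewrite big_const_seq count_predT iter_addr addr0 cardfE mulr_natr. Qed.

(** As [w] runs over the group, [x w] lies in [B] and [y w] in [A] for
    [|A| overlap A B (x y^-1)] values of [w] (substitute [a = y w]).  The claimed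
    kernel is thus [|A|^-1] times the sum over [w] of the localised ones.  In the
    sum of their bounds each [|xi y|^2] is counted [|A|] times and each
    [|eta x|^2] at most [|B|] times. *)
Lemma kernel_le_overlap E F A B k c : 0 <= c -> A != fset0 -> (A `<=` B)%fset ->
  (forall w, kernel_le E F
     (fun x y => if ((x * w)%g \in B) && ((y * w)%g \in A) then k x y else 0) c) ->
  kernel_le E F (fun x y => (overlap A B (x * y^-1)%g)%:C * k x y)
    (c * (#|` B|%:R / #|` A|%:R)).
Proof.
move=> c0 A0 AB hw xi eta.
have cA : 0 < #|` A|%:R :> R by rewrite ltr0n cardfs_gt0.
have cAB : #|` A|%:R <= #|` B|%:R :> R by rewrite ler_nat fsubset_leq_card.
(* All w with y w in A for some column y in E. *)
pose W := [fset (y^-1 * a)%g | y in E, a in A]%fset.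
pose xi_ w y := if (y * w)%g \in A then xi y else 0.
pose eta_ w x := if (x * w)%g \in B then eta x else 0.
pose k_ w x y := if ((x * w)%g \in B) && ((y * w)%g \in A) then k x y else 0.
have overlapE x y : y \in E -> overlap A B (x * y^-1)%g = (#|` A|%:R)^-1 *
    \sum_(w <- W) (if (y * w)%g \in A then if (x * w)%g \in B then 1 else 0 else 0).
  move=> yE; congr (_ * _).
  rewrite -(@sum_preimage_eq W A (fun w => (y * w)%g)); last 2 first.
  - exact: mulgI.
  - move=> a aA; exists (y^-1 * a)%g; last by rewrite mulVKg.
    by apply/imfset2P; exists y => //; exists a.
  by apply: eq_bigr => w _; rewrite divgKA.
have -> : pairing E F (fun x y => (overlap A B (x * y^-1)%g)%:C * k x y) xi eta =
    (#|` A|%:R)^-1 * \sum_(w <- W) pairing E F (k_ w) (xi_ w) (eta_ w).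
  rewrite /pairing [in RHS]exchange_big mulr_sumr; apply: eq_bigr => x _.
  rewrite [in RHS]exchange_big mulr_sumr; apply: eq_big_seq => y yE.
  rewrite -mulrA Re_real_mul overlapE// -mulrA; congr (_ * _).
  rewrite mulr_suml; apply: eq_bigr => w _; rewrite /k_ /xi_ /eta_.
  by case: (_ \in A); case: (_ \in B); rewrite /= ?(mul1r, mul0r, mulr0, subr0).
have sumE (P D : {fset G}) (g : G -> R[i]) :
  \sum_(w <- W) sqn D (fun y => if (y * w)%g \in P then g y else 0) <= #|` P|%:R * sqn D g.
  rewrite /sqn exchange_big mulr_sumr; apply: ler_sum => y _.
  rewrite mulrC -sum_cst_fset; apply: (le_trans _ (sum_preimage_le W P (mulgI y) _)).
    rewrite le_eqVlt; apply/orP; left; apply/eqP; apply: eq_bigr => w _.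
    by case: ifP => //; rewrite normc0 expr0n.
  by move=> _; exact: sqr_ge0.
rewrite mulrCA -[leRHS](_ : (#|` A|%:R)^-1 * (c * (#|` B|%:R * (sqn E xi + sqn F eta))) = _).
  2: by ring.
rewrite ler_pM2l ?invr_gt0//.
apply: (@le_trans _ _ (\sum_(w <- W) c * (sqn E (xi_ w) + sqn F (eta_ w)))).
  by rewrite mulr_sumr; apply: ler_sum => w _; exact: hw.
rewrite -mulr_sumr ler_wpM2l// big_split/= mulrDr lerD//.
  by apply: (le_trans (sumE _ _ _)); rewrite ler_wpM2r ?sqn_ge0.
exact: sumE.
Qed.

End Averaging.

(** * Cutoffs and dyadic decomposition *)

Definition conv_kernel (R : realType) (G : groupType) (f : G -> R[i]) (x y : G) : R[i] :=
  f (x * y^-1)%g.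

Definition comm_kernel (R : realType) (G : groupType) (L : G -> R) (f : G -> R[i])
  (x y : G) : R[i] := (L x - L y)%:C * f (x * y^-1)%g.

Section Decomposition.
Variables (R : realType) (G : groupType) (L : G -> R).
Hypotheses (hL : length_function L) (finL : forall r, finite_set (lball L r)).
Implicit Types (f g : G -> R[i]) (r c : R).

Definition ballF r : {fset G} := fset_set (lball L r).

Lemma in_ballF r x : (x \in ballF r) = (L x <= r).
Proof. by rewrite /ballF in_fset_set//; apply/idP/idP; rewrite inE. Qed.

Lemma length1 : L 1%g = 0. Proof. by apply/(length_eq0 hL). Qed.

Lemma ballF_neq0 r : 0 <= r -> ballF r != fset0.
Proof. by move=> r0; apply/fset0Pn; exists 1%g; rewrite in_ballF length1. Qed.

Lemma ballF_sub r s : r <= s -> (ballF r `<=` ballF s)%fset.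
Proof.
by move=> rs; apply/fsubsetP => x; rewrite !in_ballF => /le_trans; apply.
Qed.

Lemma card_ballF_gt0 r : 0 <= r -> 0 < #|` ballF r|%:R :> R.
Proof. by move=> r0; rewrite ltr0n cardfs_gt0 ballF_neq0. Qed.

Definition cutoff r : G -> R := overlap R (ballF r) (ballF (2 * r)).

Lemma overlap_ballF1 r s x : 0 <= r -> L x + r <= s ->
  overlap R (ballF r) (ballF s) x = 1.
Proof.
move=> r0 xs; rewrite /overlap (_ : \sum_(a <- _) _ = #|` ballF r|%:R).
  by rewrite mulVf// gt_eqF// card_ballF_gt0.
rewrite -[RHS]mul1r -sum_cst_fset; apply: eq_big_seq => a; rewrite in_ballF => ar.
by rewrite in_ballF (le_trans (length_mul hL _ _))// (le_trans _ xs)// lerD2l.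
Qed.

Lemma cutoff_eq1 r x : 0 <= r -> L x <= r -> cutoff r x = 1.
Proof. by move=> r0 xr; apply: overlap_ballF1 => //; rewrite mulr_natl mulr2n lerD2r. Qed.

Lemma length_mulr_ge x y : L x - L y <= L (x * y)%g.
Proof. by rewrite lerBlDr -{1}(mulgK y x) -(length_inv hL y) (length_mul hL). Qed.

Lemma cutoff_eq0 r x : 3 * r < L x -> cutoff r x = 0.
Proof.
move=> xr; rewrite /cutoff /overlap big1_seq ?mulr0// => a /=.
rewrite !in_ballF => ar; case: ifP => // xar.
by have := length_mulr_ge x a; lra.
Qed.

Variable C : R.
Hypothesis doubling : forall r, 1 <= r -> #|` ballF (2 * r)|%:R <= C * #|` ballF r|%:R.

Lemma doubling_ge1 : 1 <= C.
Proof.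
have B1 : 0 < #|` ballF 1|%:R :> R by rewrite card_ballF_gt0.
rewrite -(ler_pM2r B1) mul1r; apply: (le_trans _ (doubling (lexx 1))).
by rewrite ler_nat fsubset_leq_card// ballF_sub// mulr1 ler1n.
Qed.

Lemma doubling_iter r n : 1 <= r ->
  #|` ballF (2 ^+ n * r)|%:R <= C ^+ n * #|` ballF r|%:R.
Proof.
move=> r1; elim: n => [|n IH]; first by rewrite !expr0 !mul1r.
have C0 : 0 <= C := le_trans ler01 doubling_ge1.
rewrite !exprS -!mulrA; apply: (le_trans (doubling _)); last by rewrite ler_wpM2l.
by rewrite (le_trans r1)// ler_peMl ?exprn_ege1 ?ler1n ?(le_trans ler01).
Qed.

Lemma comm_kernel_cutoff f c r : 0 <= c -> 1 <= r ->
  kernel_bounded (comm_kernel L f) c ->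
  kernel_bounded (comm_kernel L (fun x => (cutoff r x)%:C * f x)) (c * C).
Proof.
move=> c0 r1 hf E F; have r0 : 0 <= r := le_trans ler01 r1.
apply: (@kernel_le_weaken _ _ _ _ _ (c * (#|` ballF (2 * r)|%:R / #|` ballF r|%:R))).
  by rewrite ler_wpM2l// ler_pdivrMr ?card_ballF_gt0 ?doubling.
apply: eq_kernel_le (kernel_le_overlap (k := comm_kernel L f) c0 (ballF_neq0 r0) _ _).
- by move=> x y _ _; rewrite /comm_kernel /cutoff mulrCA.
- by apply: ballF_sub; rewrite mulr_natl mulr2n lerDl.
- by move=> w; exact: (kernel_le_restrict (fun x => (x * w)%g \in _) (fun y => (y * w)%g \in _)).
Qed.

(** Apply [kernel_le_overlap] with [A = B(r/4)] and [B = B(8r)]: the overlap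
    function is [1] on the support of [g] since [6r + r/4 <= 8r].  For the local
    bounds use [kernel_le_sylvester] with the translated length [L (x w)]: if
    [L (y w) <= r/4] and [r < L (x y^-1)] then [L (x w) >= 3r/4].  As
    [8r = 2^5 (r/4)], five doublings compare the two balls; [4 <= r] makes
    [r/4] an admissible radius for them. *)
Lemma conv_kernel_annulus g c r : 0 <= c -> 4 <= r ->
  (forall x, g x != 0 -> r < L x <= 6 * r) ->
  kernel_bounded (comm_kernel L g) c ->
  kernel_bounded (conv_kernel g) (2 * c * C ^+ 5 / r).
Proof.
move=> c0 r4 supp hg E F; have r0 : 0 < r by lra.
pose A := ballF (r / 4); pose B := ballF (8 * r).
have cA : 0 < #|` A|%:R :> R by rewrite card_ballF_gt0// divr_ge0// ltW.
have cBA : #|` B|%:R / #|` A|%:R <= C ^+ 5.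
  rewrite ler_pdivrMr// /B (_ : 8 * r = 2 ^+ 5 * (r / 4)); last by field.
  by apply: doubling_iter; rewrite ler_pdivlMr// mul1r.
have local w : kernel_le E F (fun x y => if ((x * w)%g \in B) && ((y * w)%g \in A)
    then conv_kernel g x y else 0) (2 * c / r).
  rewrite (_ : 2 * c / r = c / (3 * r / 4 - r / 4)); last by field; rewrite ?gt_eqF /=; lra.
  apply: (kernel_le_sylvester (l := fun x => L (x * w)%g)) => //; try lra.
    move=> x y; case: ifP => [/andP[_]|]; last by rewrite eqxx.
    rewrite in_ballF => yA /supp/andP[xy _]; split; last by rewrite yA (length_ge0 hL).
    have := length_mulr_ge (x * y^-1)%g (y * w)%g.
    by rewrite divgKA; move: (L (x * w)%g) => ?; lra.
  apply: eq_kernel_le (kernel_le_restrict (fun x => (x * w)%g \in B) (fun y => (y * w)%g \in A) c0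
    (kernel_bounded_translate w hg E F)) => x y _ _.
  rewrite /comm_kernel /conv_kernel invgM mulgA mulgK.
  by case: ifP; rewrite ?mulr0.
apply: (@kernel_le_weaken _ _ _ _ _ (2 * c / r * (#|` B|%:R / #|` A|%:R))).
  by rewrite [leRHS]mulrAC ler_wpM2l// divr_ge0 ?mulr_ge0// ltW.
apply: eq_kernel_le (kernel_le_overlap _ _ _ local) => //.
- move=> x y _ _; rewrite /conv_kernel.
  have [->|g0] := eqVneq (g (x * y^-1)%g) 0; first by rewrite mulr0.
  have /andP[_ ?] := supp _ g0; rewrite overlap_ballF1 ?mul1r//; lra.
- by rewrite divr_ge0 ?mulr_ge0// ltW.
- by rewrite ballF_neq0 ?divr_ge0 ?(ltW r0).
- by apply: ballF_sub; lra.
Qed.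

(** Both cutoffs are [1] on [B(2^j)] and [0] off [B(6 2^j)], so their difference
    lives on an annulus. *)
Lemma conv_kernel_dyadic f c j : 0 <= c -> kernel_bounded (comm_kernel L f) c -> (2 <= j)%N ->
  kernel_bounded
   (conv_kernel (fun x => (cutoff (2 ^+ j.+1) x - cutoff (2 ^+ j) x)%:C * f x))
   (4 * c * C ^+ 6 / 2 ^+ j).
Proof.
move=> c0 hf j2; have C1 := doubling_ge1.
have pow1 n : 1 <= 2 ^+ n :> R by rewrite exprn_ege1// ler1n.
rewrite (_ : 4 * c * C ^+ 6 = 2 * (c * C + c * C) * C ^+ 5); last by ring.
apply: conv_kernel_annulus.
- by rewrite addr_ge0// mulr_ge0// (le_trans ler01).
- by rewrite (_ : 4 = 2 ^+ 2) ?ler_eXn2l ?ltr1n// -natrX.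
- move=> x; set d := cutoff _ x - _ => gx0.
  have d0 : d != 0 by apply: contraNneq gx0 => ->; rewrite mul0r.
  have e2 : 2 ^+ j.+1 = 2 * 2 ^+ j :> R by rewrite exprS.
  have := pow1 j => p1.
  rewrite ltNge; apply/andP; split; apply/negP => hx; apply/negP: d0; apply/negPn/eqP.
    by rewrite /d !cutoff_eq1 ?subrr//; lra.
  by move: hx => /negP; rewrite -ltNge => hx; rewrite /d !cutoff_eq0 ?subrr//; lra.
- move=> E F.
  apply: eq_kernel_le (kernel_leD (comm_kernel_cutoff c0 (pow1 j.+1) hf E F)
     (kernel_leN (comm_kernel_cutoff c0 (pow1 j) hf E F))) => x y _ _.
  by rewrite /comm_kernel rmorphB/=; ring.
Qed.

(** On a finite block only finitely many values of [f] occur, and there [1] is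
    the cutoff at a sufficiently large scale.  The tail is then a finite
    telescoping sum of dyadic pieces, whose bounds form a geometric series. *)
Lemma conv_kernel_tail f c J : 0 <= c -> kernel_bounded (comm_kernel L f) c -> (2 <= J)%N ->
  kernel_bounded (conv_kernel (fun x => (1 - cutoff (2 ^+ J) x)%:C * f x))
   (8 * c * C ^+ 6 / 2 ^+ J).
Proof.
move=> c0 hf J2 E F.
pose M := \sum_(x <- F) \sum_(y <- E) L (x * y^-1)%g.
have LM x y : x \in F -> y \in E -> L (x * y^-1)%g <= M.
  move=> xF yE; rewrite /M (big_fsetD1 x)//= (big_fsetD1 y)//= -addrA lerDl.
  by rewrite addr_ge0// sumr_ge0// => *; rewrite ?sumr_ge0// => *; exact: (length_ge0 hL).
have M0 : 0 <= M by rewrite sumr_ge0// => *; rewrite sumr_ge0// => *; exact: (length_ge0 hL).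
pose n := Num.bound M.
have Mn : M <= 2 ^+ (J + n).
  apply: (le_trans (ltW (archi_boundP M0))).
  by rewrite -natrX ler_nat (leq_trans (ltnW (ltn_expl n (ltnSn 1))))// leq_pexp2l// leq_addl.
pose K := 4 * c * C ^+ 6.
have pieces i : kernel_le E F (conv_kernel (fun x =>
    (cutoff (2 ^+ (J + i).+1) x - cutoff (2 ^+ (J + i)) x)%:C * f x)) (K / 2 ^+ (J + i)).
  by apply: conv_kernel_dyadic => //; rewrite (leq_trans J2)// leq_addr.
apply: (@kernel_le_weaken _ _ _ _ _ (\sum_(0 <= i < n) K / 2 ^+ (J + i))).
  rewrite (eq_bigr (fun i => - (2 * K / 2 ^+ (J + i.+1)) - - (2 * K / 2 ^+ (J + i)))).
    rewrite telescope_sumr// addn0 (_ : 8 * c * C ^+ 6 = 2 * K); last by rewrite /K; ring.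
    rewrite opprK gerDr oppr_le0 divr_ge0 ?exprn_ge0//.
    by rewrite /K !mulr_ge0 ?exprn_ge0 ?(le_trans ler01 doubling_ge1).
  by move=> i _; rewrite addnS exprS; field; rewrite expf_neq0.
apply: eq_kernel_le (kernel_le_sum (index_iota 0 n) pieces) => x y xF yE.
rewrite /conv_kernel -mulr_suml -rmorph_sum.
rewrite (eq_bigr (fun i => cutoff (2 ^+ (J + i.+1)) (x / y)%g - cutoff (2 ^+ (J + i)) (x / y)%g)).
  rewrite telescope_sumr// addn0 (@cutoff_eq1 (2 ^+ (J + n)))// ?exprn_ge0//.
  exact: le_trans (LM _ _ xF yE) Mn.
by move=> i _; rewrite addnS.
Qed.

Lemma comm_kernel_split c eps : 0 <= c -> 0 < eps -> exists S : {fset G}, forall f,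
  kernel_bounded (comm_kernel L f) c -> exists fsharp fflat : G -> R[i],
    [/\ forall x, f x = fsharp x + fflat x,
        forall x, x \notin S -> fflat x = 0 & kernel_bounded (conv_kernel fsharp) eps].
Proof.
move=> c0 eps0; pose K := 8 * c * C ^+ 6.
have K0 : 0 <= K by rewrite /K !mulr_ge0 ?exprn_ge0 ?(le_trans ler01 doubling_ge1).
have [J J2 KJ] : exists2 J, (2 <= J)%N & K / 2 ^+ J <= eps.
  have := ltW (archi_boundP (divr_ge0 K0 (ltW eps0))).
  move: (Num.bound _) => n Kn; exists n.+2 => //.
  rewrite ler_pdivrMr ?exprn_gt0// mulrC -ler_pdivrMr// (le_trans Kn)//.
  rewrite -natrX ler_nat (leq_trans (ltnW (ltn_expl n (ltnSn 1))))//.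
  by rewrite leq_exp2l// !leqW.
exists (ballF (3 * 2 ^+ J)) => f hf; pose phi := cutoff (2 ^+ J).
exists (fun x => (1 - phi x)%:C * f x), (fun x => (phi x)%:C * f x); split.
- by move=> x; rewrite -mulrDl -rmorphD subrK rmorph1 mul1r.
- by move=> x; rewrite in_ballF -ltNge => /cutoff_eq0; rewrite /phi => ->; rewrite mul0r.
- by move=> E F; apply: (kernel_le_weaken KJ); exact: conv_kernel_tail.
Qed.

End Decomposition.

(** * From finite blocks to square-summable functions *)

Section FiniteNorms.
Variables (R : realType) (G : groupType).
Implicit Types (E F : {fset G}) (k : G -> G -> R[i]) (xi eta f : G -> R[i]) (c q : R).

(** Young's inequality for a finitely supported function: the kernel is a sum of
    scalar multiples of the permutation kernels [x = s y]. *)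
Lemma kernel_le_conv_fin f (S : {fset G}) :
  (forall x, x \notin S -> f x = 0) ->
  kernel_bounded (conv_kernel f) (\sum_(s <- S) normc (f s)).
Proof.
move=> fS E F.
have single s : kernel_le E F (fun x y => if x == (s * y)%g then f s else 0) (normc (f s)).
  move=> xi eta.
  pose I x y := if x == (s * y)%g then 1 else 0 : R.
  have pt (v : R) z : v = \sum_(b <- [fset z : G]%fset) v by rewrite big_seq_fset1.
  apply: (@le_trans _ _ (\sum_(x <- F) \sum_(y <- E)
      normc (f s) * (I x y * normc (xi y) ^+ 2 + I x y * normc (eta x) ^+ 2))).
    rewrite /pairing mulr_sumr; apply: ler_sum => x _; rewrite mulr_sumr.
    apply: ler_sum => y _; rewrite /I; case: ifP => _; last by rewrite !mul0r /= mulr0 addr0 mulr0.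
    rewrite !mul1r.
    apply: (@le_trans _ _ (2 * (normc (f s) * (normc (xi y) * normc (eta x))))).
      by rewrite ler_pM2l// -!normcM Re_le_normc.
    rewrite mulrCA ler_wpM2l ?normc_ge0//.
    by have := sqr_ge0 (normc (xi y) - normc (eta x)); nra.
  under eq_bigr => x _ do rewrite -mulr_sumr big_split/=.
  rewrite -mulr_sumr big_split/= ler_wpM2l ?normc_ge0// lerD//.
    rewrite exchange_big/=; apply: ler_sum => y _; rewrite [leRHS](pt _ (s * y)%g).
    apply: (le_trans _ (sum_preimage_le F [fset (s * y)%g]%fset (s := id) _ _)) => //.
    - rewrite le_eqVlt; apply/orP; left; apply/eqP; apply: eq_bigr => x _.
      by rewrite /I inE; case: ifP; rewrite ?(mul1r, mul0r).
    - by move=> ?; exact: sqr_ge0.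
  apply: ler_sum => x _; rewrite [leRHS](pt _ x).
  apply: (le_trans _ (sum_preimage_le E [fset x]%fset (s := fun y => (s * y)%g) _ _)) => //.
  - rewrite le_eqVlt; apply/orP; left; apply/eqP; apply: eq_bigr => y _.
    by rewrite /I inE eq_sym; case: ifP; rewrite ?(mul1r, mul0r).
  - exact: mulgI.
  - by move=> ?; exact: sqr_ge0.
apply: eq_kernel_le (kernel_le_sum S single) => x y _ _.
rewrite /conv_kernel.
rewrite (eq_bigr (fun s => if s == (x * y^-1)%g then f s else 0)); last first.
  by move=> s _; rewrite -(inj_eq (mulIg y^-1)%g) mulgK eq_sym.
have [xyS|xyS] := boolP ((x * y^-1)%g \in S).
  rewrite (big_fsetD1 _ xyS)/= eqxx big1_seq ?addr0// => s.
  by rewrite !inE => /andP[_ /andP[/negbTE ->]].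
rewrite fS// big1_seq// => s /= sS; case: eqP => // sxy.
by rewrite -sxy sS in xyS.
Qed.

(** Test the bilinear bound against [eta = conj(s) / c], where [s] is the image
    of [xi]; this choice balances the two sides. *)
Lemma kernel_le_sqn E F k c xi : 0 < c -> kernel_le E F k c ->
  sqn F (fun x => \sum_(y <- E) k x y * xi y) <= c ^+ 2 * sqn E xi.
Proof.
move=> c0 h; set s := fun x => _.
pose eta x : R[i] := (c^-1)%:C * (s x)^*%C.
have := h xi eta.
have -> : pairing E F k xi eta = c^-1 * sqn F s.
  rewrite /pairing /sqn mulr_sumr; apply: eq_bigr => x _.
  rewrite -Re_sum -Re_conj_mul -Re_real_mul mulrCA -/(eta x); congr complex.Re.
  by rewrite mulr_suml; apply: eq_bigr => y _; rewrite mulrA.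
have -> : sqn F eta = c^-1 ^+ 2 * sqn F s.
  rewrite /sqn mulr_sumr; apply: eq_bigr => x _.
  by rewrite /eta normcM normc_real normc_conj exprMn ger0_norm// invr_ge0 ltW.
move: (sqn F s) (sqn E xi) => S Q hS.
have := ler_wpM2l (ltW c0) hS.
rewrite [X in X <= _](_ : _ = 2 * S); last by field; rewrite gt_eqF.
rewrite [X in _ <= X](_ : _ = c ^+ 2 * Q + S); last by field; rewrite gt_eqF.
lra.
Qed.

Lemma kernel_le_of_sqn E F k :
  (forall xi, sqn F (fun x => \sum_(y <- E) k x y * xi y) <= sqn E xi) ->
  kernel_le E F k 1.
Proof.
move=> h xi eta; rewrite mul1r; apply: (le_trans _ (lerD (h xi) (lexx _))).
rewrite /pairing /sqn mulr_sumr -big_split/=; apply: ler_sum => x _.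
rewrite -Re_sum (_ : \sum_(y <- E) _ = (\sum_(y <- E) k x y * xi y) * eta x).
  by rewrite (le_trans (ler_wpM2l _ (Re_le_normc _)))// normcM;
     have := sqr_ge0 (normc (\sum_(y <- E) k x y * xi y) - normc (eta x)); nra.
by rewrite mulr_suml; apply: eq_bigr => y _; rewrite mulrA.
Qed.

(** Dually to [kernel_le_sqn], test a single row against its own conjugate. *)
Lemma kernel_row_sqn k c : 0 < c -> kernel_bounded k c ->
  forall x E, sqn E (k x) <= c ^+ 2.
Proof.
move=> c0 hk x E.
pose xi y : R[i] := (c^-1)%:C * (k x y)^*%C.
have := hk E [fset x]%fset xi (fun=> 1).
have -> : pairing E [fset x]%fset k xi (fun=> 1) = c^-1 * sqn E (k x).
  rewrite /pairing big_seq_fset1 /sqn mulr_sumr; apply: eq_bigr => y _.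
  rewrite -Re_conj_mul -Re_real_mul /xi; congr complex.Re; ring.
have -> : sqn E xi = c^-1 ^+ 2 * sqn E (k x).
  rewrite /sqn mulr_sumr; apply: eq_bigr => y _.
  by rewrite /xi normcM normc_real normc_conj exprMn ger0_norm// invr_ge0 ltW.
rewrite /sqn big_seq_fset1 normc1 expr1n.
move: (\sum_(y <- E) _) => S hS.
have := ler_wpM2l (ltW c0) hS.
rewrite [X in X <= _](_ : _ = 2 * S); last by field; rewrite gt_eqF.
rewrite [X in _ <= X](_ : _ = c ^+ 2 + S); last by field; rewrite gt_eqF.
lra.
Qed.

Lemma fsbig_support E (h : G -> R[i]) : (forall y, y \notin E -> h y = 0) ->
  \sum_(y \in [set: G]) h y = \sum_(y <- E) h y.
Proof.
move=> h0; rewrite [in RHS]fsbig_seq ?fset_uniq//; apply/esym; apply: fsbig_widen => //.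
by move=> y [_ /= /negP yE]; exact: h0.
Qed.

Lemma sqn_sqsum xi q : (forall E, sqn E xi <= q) -> (sqsum xi <= q%:E)%E.
Proof.
move=> h; apply: ge_ereal_sup => _ [A [finA _] <-].
rewrite fsbig_finite//= sumEFin lee_fin; exact: h.
Qed.

Lemma sqsum_fin_num (xi : l2 R G) : sqsum xi \is a fin_num.
Proof.
rewrite ge0_fin_numE; first exact: (l2P xi).
by apply: esum_ge0 => x _; rewrite lee_fin sqr_ge0.
Qed.

Lemma sqsum_sqn E (xi : l2 R G) : sqn E xi <= fine (sqsum xi).
Proof.
rewrite -lee_fin (fineK (sqsum_fin_num xi)).
rewrite /sqn -sumEFin fsbig_seq ?fset_uniq//.
by apply: ereal_sup_ubound; exists [set` E].
Qed.

Lemma fine_sqsum_ge0 xi : 0 <= fine (sqsum xi).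
Proof. by apply/fine_ge0/esum_ge0 => x _; rewrite lee_fin sqr_ge0. Qed.

Lemma opnorm_le (T : l2 R G -> l2 R G) c : 0 <= c ->
  (forall (xi : l2 R G) E, sqn E (T xi) <= c ^+ 2 * fine (sqsum xi)) -> (opnorm T <= c%:E)%E.
Proof.
move=> c0 h; apply: ge_ereal_sup => _ [xi /= xi1 <-]; rewrite lee_fin.
rewrite -(ger0_norm c0) -sqrtr_sqr ler_sqrt ?sqr_ge0//.
rewrite -lee_fin; apply: (@le_trans _ _ (sqsum (T xi))).
  by rewrite (fineK (sqsum_fin_num _)).
apply: sqn_sqsum => E; apply: (le_trans (h xi E)).
rewrite -[leRHS]mulr1 ler_wpM2l ?sqr_ge0//.
rewrite -(sqr_sqrtr (fine_sqsum_ge0 xi)) -(expr1n _ 2).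
by rewrite lerXn2r// nnegrE ?sqrtr_ge0.
Qed.

Lemma sqnZ E (a : R[i]) xi : sqn E (fun x => a * xi x) = normc a ^+ 2 * sqn E xi.
Proof. by rewrite /sqn mulr_sumr; apply: eq_bigr => x _; rewrite normcM exprMn. Qed.

(** [opnorm] is a supremum over the unit ball only.  Scaling [xi] by
    [(q + e)^(-1/2)], with [q] its squared norm and [e > 0], puts it in the unit
    ball even if [q = 0]; then [e] tends to [0]. *)
Lemma opnorm_sqn (T : {linear l2 R G -> l2 R G}) c : (opnorm T <= c%:E)%E ->
  forall (xi : l2 R G) E, sqn E (T xi) <= c ^+ 2 * fine (sqsum xi).
Proof.
move=> Tc xi E; set q := fine (sqsum xi).
have q0 : 0 <= q := fine_sqsum_ge0 xi.
have key e : 0 < e -> sqn E (T xi) <= c ^+ 2 * (q + e).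
  move=> e0; have qe0 : 0 < q + e by rewrite ltr_wpDl.
  pose t := Num.sqrt (q + e); have t0 : 0 < t by rewrite sqrtr_gt0.
  have t2 : t ^+ 2 = q + e by rewrite sqr_sqrtr// ltW.
  pose a : R[i] := (t^-1)%:C.
  have na : normc a ^+ 2 = (q + e)^-1 by rewrite normc_real ger0_norm ?invr_ge0 ?(ltW t0)// exprVn t2.
  have h1 : l2norm (a *: xi) <= 1.
    rewrite /l2norm -sqrtr1 ler_sqrt ?ler01// -lee_fin (fineK (sqsum_fin_num _)).
    apply: sqn_sqsum => D.
    rewrite (_ : sqn D _ = normc a ^+ 2 * sqn D xi); last exact: sqnZ.
    rewrite na -(mulVf (lt0r_neq0 qe0)) ler_wpM2l ?invr_ge0 ?(ltW qe0)//.
    by apply: (le_trans (sqsum_sqn D xi)); rewrite -/q lerDl ltW.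
  have h2 : l2norm (T (a *: xi)) <= c.
    by rewrite -lee_fin (le_trans _ Tc)//; apply: ereal_sup_ubound; exists (a *: xi).
  have h3 : sqn E (T (a *: xi)) <= c ^+ 2.
    apply: (le_trans (sqsum_sqn E _)).
    rewrite -(sqr_sqrtr (fine_sqsum_ge0 _)) lerXn2r// nnegrE ?sqrtr_ge0//.
    exact: le_trans (sqrtr_ge0 _) h2.
  move: h3; rewrite linearZ/= (_ : sqn E _ = normc a ^+ 2 * sqn E (T xi)); last exact: sqnZ.
  by rewrite na mulrC ler_pdivrMr.
apply/ler_addgt0Pl => e e0.
have c1 : 0 < c ^+ 2 + 1 by rewrite ltr_wpDl// sqr_ge0.
(* This choice of e makes the error at most the given one, also for c = 0. *)
have := key (e / (c ^+ 2 + 1)) (divr_gt0 e0 c1).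
rewrite mulrDr addrC => /le_trans; apply.
rewrite lerD2r mulrCA ler_piMr ?(ltW e0)// ler_pdivrMr// mul1r lerDl//.
Qed.

End FiniteNorms.

(** * Extending kernels to bounded operators *)

Section Extension.
Variables (R : realType) (G : groupType) (L : G -> R).
Hypotheses (hL : length_function L) (finL : forall r, finite_set (lball L r)).
Implicit Types (E F : {fset G}) (k : G -> G -> R[i]) (f : G -> R[i]) (c : R).

(** Sums over the group are limits along the balls of integer radius, which are
    finite and exhaust the group; real and imaginary parts are treated
    separately. *)
Definition csum_to (a : G -> R[i]) (z : R[i]) :=
  (\sum_(y <- ballF L n%:R) complex.Re (a y)) @[n --> \oo] --> complex.Re z /\
  (\sum_(y <- ballF L n%:R) complex.Im (a y)) @[n --> \oo] --> complex.Im z.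

Definition csum (a : G -> R[i]) : R[i] :=
  Complex (limn (fun n => \sum_(y <- ballF L n%:R) complex.Re (a y)))
          (limn (fun n => \sum_(y <- ballF L n%:R) complex.Im (a y))).

Definition csummable (a : G -> R[i]) := exists M, forall E, \sum_(y <- E) normc (a y) <= M.

Lemma csum_toP a z : csum_to a z -> csum a = z.
Proof. by case: z => p q [/cvg_lim h1 /cvg_lim h2]; rewrite /csum h1// h2. Qed.

(** The partial sums of [a] are differences of those of [b] and [b - a], which
    are nondecreasing and bounded. *)
Lemma rsum_cvg (a b : G -> R) M : (forall y, `|a y| <= b y) ->
  (forall E, \sum_(y <- E) b y <= M) ->
  cvgn (fun n => \sum_(y <- ballF L n%:R) a y).
Proof.
move=> ab hM.
have mono (u : G -> R) : (forall y, 0 <= u y) -> (forall E, \sum_(y <- E) u y <= 2 * M) ->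
    cvgn (fun n => \sum_(y <- ballF L n%:R) u y).
  move=> u0 uM; apply: nondecreasing_is_cvgn.
    by move=> m n mn; apply: sum_fset_le => //; apply: ballF_sub => //; rewrite ler_nat.
  by exists (2 * M) => _ [n _ <-]; exact: uM.
have M0 : 0 <= M by have := hM fset0; rewrite big_seq_fset0.
have b0 y : 0 <= b y := le_trans (normr_ge0 _) (ab y).
rewrite (_ : (fun n => _) = (fun n => \sum_(y <- ballF L n%:R) b y) -
   (fun n => \sum_(y <- ballF L n%:R) (b y - a y))); last first.
  by apply/funext => n; rewrite -[RHS]sumrB; apply: eq_bigr => y _; rewrite opprB addrC subrK.
apply: is_cvgB; apply: mono => //.
- by move=> E; apply: (le_trans (hM E)); lra.
- by move=> y; rewrite subr_ge0 (le_trans (ler_norm _)).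
- move=> E; apply: (@le_trans _ _ (\sum_(y <- E) 2 * b y)).
    by apply: ler_sum => y _; have := ab y; rewrite ler_norml => /andP[]; lra.
  by rewrite -mulr_sumr ler_pM2l.
Qed.

Lemma csum_cvg a : csummable a -> csum_to a (csum a).
Proof.
move=> [M hM].
split; apply: (@rsum_cvg _ (fun y => normc (a y)) M) hM => y.
  by rewrite -sqrtr_sqr; case: (a y) => p q /=; rewrite ler_sqrt ?lerDl ?addr_ge0 ?sqr_ge0.
by rewrite -sqrtr_sqr; case: (a y) => p q /=; rewrite ler_sqrt ?lerDr ?addr_ge0 ?sqr_ge0.
Qed.

Lemma csum_linear (c : R[i]) a b : csummable a -> csummable b ->
  csum (fun y => c * a y + b y) = c * csum a + csum b.
Proof.
move=> /csum_cvg [a1 a2] /csum_cvg [b1 b2]; apply: csum_toP.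
move: a1 a2 b1 b2; case: (csum a) => p q; case: (csum b) => p' q'.
case: c => s t /= a1 a2 b1 b2; split.
  rewrite [X in X @ _ --> _](_ : _ = fun n => (s * (\sum_(y <- ballF L n%:R) complex.Re (a y))
     - t * (\sum_(y <- ballF L n%:R) complex.Im (a y))) + \sum_(y <- ballF L n%:R) complex.Re (b y)).
    by apply: cvgD => //; apply: cvgB; apply: cvgMr.
  apply/funext => n; rewrite !mulr_sumr -sumrB -big_split/=; apply: eq_bigr => y _.
  by case: (a y) => ? ?; case: (b y).
rewrite [X in X @ _ --> _](_ : _ = fun n => (s * (\sum_(y <- ballF L n%:R) complex.Im (a y))
   + t * (\sum_(y <- ballF L n%:R) complex.Re (a y))) + \sum_(y <- ballF L n%:R) complex.Im (b y)).
  by apply: cvgD => //; apply: cvgD; apply: cvgMr.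
apply/funext => n; rewrite !mulr_sumr -2!big_split/=; apply: eq_bigr => y _.
by case: (a y) => ? ?; case: (b y).
Qed.

Lemma csum_fin a E : (forall y, y \notin E -> a y = 0) -> csum a = \sum_(y <- E) a y.
Proof.
move=> aE; apply: csum_toP.
have [N EN] : exists N, (E `<=` ballF L N%:R)%fset.
  exists (Num.bound (\sum_(y <- E) L y)); apply/fsubsetP => y yE; rewrite in_ballF//.
  have s0 D : 0 <= \sum_(y <- D) L y by rewrite sumr_ge0// => *; exact: (length_ge0 hL).
  apply: (le_trans _ (ltW (archi_boundP (s0 E)))).
  by rewrite (big_fsetD1 y)//= lerDl s0.
have sub n : (N <= n)%N -> (E `<=` ballF L n%:R)%fset.
  by move=> Nn; apply: (fsubset_trans EN); apply: ballF_sub => //; rewrite ler_nat.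
split; apply: cvg_near_cst; exists N => // n /= /sub En.
  by rewrite Re_sum; apply/esym/big_fset_incl => // y _ /aE ->.
by rewrite Im_sum; apply/esym/big_fset_incl => // y _ /aE ->.
Qed.

Definition kernel_ext k (xi : G -> R[i]) : G -> R[i] := fun x => csum (fun y => k x y * xi y).

Lemma kernel_summable k c (xi : l2 R G) x : 0 < c -> kernel_bounded k c ->
  csummable (fun y => k x y * xi y).
Proof.
move=> c0 hk; exists (c ^+ 2 + fine (sqsum xi)) => E.
apply: (le_trans _ (lerD (kernel_row_sqn c0 hk x E) (sqsum_sqn E xi))).
rewrite /sqn -big_split/=; apply: ler_sum => y _; rewrite normcM.
have := sqr_ge0 (normc (k x y) - normc (xi y)).
have := mulr_ge0 (normc_ge0 (k x y)) (normc_ge0 (xi y)).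
rewrite !expr2; nra.
Qed.

Lemma cvg_sum_seq (I : Type) (s : seq I) (u : I -> nat -> R) (l : I -> R) :
  (forall i, u i n @[n --> \oo] --> l i) ->
  (\sum_(i <- s) u i n) @[n --> \oo] --> \sum_(i <- s) l i.
Proof.
move=> h; apply: cvg_big => // -[p q]; exact: add_continuous.
Qed.

(** The bound holds for the partial sums, by [kernel_le_sqn], and passes to the
    limit because only finitely many rows are involved. *)
Lemma kernel_ext_sqn k c (xi : l2 R G) F : 0 < c -> kernel_bounded k c ->
  sqn F (kernel_ext k xi) <= c ^+ 2 * fine (sqsum xi).
Proof.
move=> c0 hk.
pose s n x := \sum_(y <- ballF L n%:R) k x y * xi y.
have cv x : (normc (s n x) ^+ 2) @[n --> \oo] --> normc (kernel_ext k xi x) ^+ 2.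
  have [h1 h2] := csum_cvg (kernel_summable xi x c0 hk).
  have eRe : (fun n => complex.Re (s n x)) =
      fun n => \sum_(y <- ballF L n%:R) complex.Re (k x y * xi y).
    by apply/funext => n; rewrite Re_sum.
  have eIm : (fun n => complex.Im (s n x)) =
      fun n => \sum_(y <- ballF L n%:R) complex.Im (k x y * xi y).
    by apply/funext => n; rewrite Im_sum.
  under eq_fun => n do rewrite normc_sqr.
  by rewrite normc_sqr; apply: cvgD; apply: cvgM; rewrite ?eRe ?eIm.
have cvF := cvg_sum_seq (s := F) cv.
rewrite -[leLHS](cvg_lim _ cvF)//; apply: limr_le; first by apply/cvg_ex; eexists; exact: cvF.
apply: nearW => n; apply: (le_trans (kernel_le_sqn xi c0 (hk (ballF L n%:R) F))).
by rewrite ler_wpM2l ?sqr_ge0// sqsum_sqn.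
Qed.

Lemma kernel_ext_ell2 k c (xi : l2 R G) : 0 < c -> kernel_bounded k c ->
  kernel_ext k xi \in @ell2 R G.
Proof.
move=> c0 hk; rewrite unfold_in; apply: (@le_lt_trans _ _ (c ^+ 2 * fine (sqsum xi))%:E).
  by apply: sqn_sqsum => F; exact: kernel_ext_sqn.
exact: ltry.
Qed.

Lemma kernel_ext_operator k c : 0 < c -> kernel_bounded k c ->
  exists T : {linear l2 R G -> l2 R G},
    (forall xi, l2val (T xi) = kernel_ext k xi) /\ (opnorm T <= c%:E)%E.
Proof.
move=> c0 hk; pose T (xi : l2 R G) := L2 (kernel_ext_ell2 xi c0 hk).
have Tlin : linear T.
  move=> a u v; apply: val_inj; apply/funext => x /=; rewrite /kernel_ext.
  rewrite -[RHS](csum_linear a (kernel_summable u x c0 hk) (kernel_summable v x c0 hk)).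
  by congr csum; apply/funext => y /=; rewrite mulrDr mulrCA.
pose TL := GRing.isLinear.Build _ _ _ _ T Tlin.
pose T' : {linear l2 R G -> l2 R G} := HB.pack T TL.
exists T'; split => //; apply: opnorm_le; first exact: ltW.
by move=> xi E; exact: kernel_ext_sqn.
Qed.

Lemma kernel_ext_Cc f (T : {linear l2 R G -> l2 R G}) :
  (forall xi, l2val (T xi) = kernel_ext (conv_kernel f) xi) -> extends_Cc (lambda f) T.
Proof.
move=> hT xi hxi; rewrite hT; apply/funext => x; rewrite /kernel_ext /lambda /=.
have xi0 y : y \notin fset_set [set x | xi x != 0] -> xi y = 0.
  by rewrite in_fset_set// => /negP yn; apply/eqP/negPn/negP => xiy; apply: yn; rewrite inE.
rewrite (@csum_fin _ (fset_set [set x | xi x != 0])); last by move=> y /xi0 ->; rewrite mulr0.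
by rewrite (fsbig_support (E := fset_set [set x | xi x != 0]))// => y /xi0 ->; rewrite mulr0.
Qed.

(** Restricting a test function to [E] gives an element of [Cc], on which the
    bounded extension is the given sum. *)
Lemma comm_kernel_bounded f : norm_extension_le (commD L f) 1 ->
  kernel_bounded (comm_kernel L f) 1.
Proof.
move=> [T [hT Tn]] E F; apply: kernel_le_of_sqn => xi.
pose xiE y := if y \in E then xi y else 0.
have xiE0 y : y \notin E -> xiE y = 0 by rewrite /xiE => /negbTE ->.
have hxi : Cc xiE.
  apply: (sub_finite_set _ (finite_fset E)) => y /=.
  by apply: contra_neqT => /xiE0.
have := opnorm_sqn Tn (L2 (Cc_ell2 hxi)) F; rewrite hT expr1n mul1r => h.
apply: (le_trans (le_trans _ h)).
  rewrite (_ : sqn F _ = sqn F (commD L f xiE))//; apply: eq_bigr => x _.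
  rewrite commDE// (fsbig_support (E := E)); last by move=> y /xiE0 ->; rewrite mulr0.
  by congr (normc _ ^+ 2); apply: eq_big_seq => y yE; rewrite /comm_kernel /xiE yE.
rewrite -lee_fin (fineK (sqsum_fin_num _)); apply: sqn_sqsum => D.
rewrite (_ : sqn E xi = sqn E xiE); last by apply: eq_big_seq => y yE; rewrite /xiE yE.
rewrite /sqn (big_fsetID _ (mem E))/= [X in _ + X]big1_seq ?addr0; last first.
  by move=> y; rewrite !inE => /= /andP[_ /xiE0 ->]; rewrite normc0 expr0n.
apply: sum_fset_le; last by move=> ?; exact: sqr_ge0.
by apply/fsubsetP => y; rewrite !inE => /andP[].
Qed.

End Extension.

Theorem mainTheorem4 (R : realType) (G : groupType) (L : G -> R)
    (hL : length_function L) (hdoubling : bounded_doubling L) :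
  (forall eps : R, 0 < eps ->
    exists S : set G, finite_set S /\
      forall f : G -> R[i], norm_extension_le (commD L f) 1 ->
        exists fsharp fflat : G -> R[i],
          [/\ forall x, f x = fsharp x + fflat x,
              forall x, ~ S x -> fflat x = 0 &
              norm_extension_le (lambda fsharp) eps])
  /\
  (forall f : G -> R[i], norm_extension_le (commD L f) 1 ->
    exists T : {linear l2 R G -> l2 R G},
      extends_Cc (lambda f) T /\ reduced_Cstar T).
Proof.
case: hdoubling => finL [C doubling].
have split_f := comm_kernel_split hL finL doubling ler01.
split.
  move=> eps eps0; have [S hS] := split_f eps eps0.
  exists [set` S]; split => // f /comm_kernel_bounded/hS.
  move=> [fsharp [fflat [ff f0 fb]]]; exists fsharp, fflat; split => //.
    by move=> x /negP; exact: f0.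
  have [T [TE Tn]] := kernel_ext_operator finL eps0 fb.
  by exists T; split => //; exact: (kernel_ext_Cc hL finL).
move=> f hf.
have pieces eps : 0 < eps -> exists fsharp fflat : G -> R[i], exists S : {fset G},
    exists c, [/\ 0 < c, forall x, f x = fsharp x + fflat x,
      forall x, x \notin S -> fflat x = 0, kernel_bounded (conv_kernel fsharp) eps &
      kernel_bounded (conv_kernel fflat) c].
  move=> eps0; have [S hS] := split_f eps eps0.
  have [fsharp [fflat [ff f0 fb]]] := hS f (comm_kernel_bounded hf).
  exists fsharp, fflat, S.
  exists (\sum_(s <- S) normc (fflat s) + 1); split => //.
    by rewrite ltr_wpDl// sumr_ge0// => *; exact: normc_ge0.
  move=> E F; apply: kernel_le_weaken (kernel_le_conv_fin f0 E F).
  by rewrite lerDl.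
(* The decomposition at scale 1 already makes lambda f bounded. *)
have [c c0 fc] : exists2 c, 0 < c & kernel_bounded (conv_kernel f) c.
  have [g [h [S [c [c0 gh _ gb hb]]]]] := pieces 1 ltr01.
  exists (1 + c); first by rewrite addr_gt0.
  by move=> E F; apply: eq_kernel_le (kernel_leD (gb E F) (hb E F)) => x y _ _; rewrite /conv_kernel gh.
have [T [TE Tn]] := kernel_ext_operator finL c0 fc.
exists T; split; first exact: (kernel_ext_Cc hL finL).
split; first by apply: (le_lt_trans Tn); rewrite ltry.
move=> e e0; have e20 : 0 < e / 2 by rewrite divr_gt0.
have [g [h [S [d [d0 gh hS gb hb]]]]] := pieces _ e20.
have [Th [ThE Thn]] := kernel_ext_operator finL d0 hb.
exists h, Th; split.
- apply: (sub_finite_set _ (finite_fset S)) => y /=.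
  by apply: contra_neqT => /hS.
- exact: (kernel_ext_Cc hL finL).
- by apply: (le_lt_trans Thn); rewrite ltry.
apply: (@le_lt_trans _ _ (e / 2)%:E); last by rewrite lte_fin ltr_pdivrMr// ltr_pMr// ltr1n.
apply: opnorm_le; first exact: ltW.
(* The difference of the two operators is the extension of lambda g. *)
move=> xi E; rewrite (_ : sqn E _ = sqn E (kernel_ext L (conv_kernel g) xi)).
  exact: kernel_ext_sqn.
apply: eq_bigr => x _; congr (normc _ ^+ 2).
rewrite -[LHS]/(l2val (T xi) x - l2val (Th xi) x) TE ThE /kernel_ext.
have := csum_linear finL 1 (kernel_summable xi x e20 gb) (kernel_summable xi x d0 hb).
rewrite mul1r => sumE; apply/eqP; rewrite subr_eq -sumE; apply/eqP.
by congr csum; apply/funext => y; rewrite mul1r /conv_kernel gh mulrDl.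
Qed.
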